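(* Let $J=\{1,\dots,n\}$, let $x_j\in\mathbb{R}^m$, $y_j\in\mathbb{R}^s$ ($j\in J$) be vectors with strictly positive components, and let $DMU_o=(x_o,y_o)$, $o\in J$, be $FDH_V$-efficient. Let $\sigma_o^+$ and $\sigma_o^-$ be its maximum incremental and minimum decremental ratios. Then the following hold for $DMU_o$: (a) If G-IRS prevails, then Right-IRS prevails; and Right-IRS prevails if and only if $\sigma_o^+>1$. (b) If G-DRS prevails, then Left-DRS prevails; and Left-DRS prevails if and only if $\sigma_o^-<1$. (c) If G-CRS prevails, then both Right-NIRS and Left-NDRS prevail; and both Right-NIRS and Left-NDRS prevail if and only if $\sigma_o^+\le1$ and $\sigma_o^-\ge1$. (d) If G-SCRS prevails, then both Right-IRS and Left-DRS prevail; and both Right-IRS and Left-DRS prevail if and only if $\sigma_o^+>1$ and $\sigma_o^-<1$.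
   Context: There are $n$ decision making units $DMU_j=(x_j,y_j)$, $j\in J$, with strictly positive input vectors $x_j\in\mathbb{R}^m$ and output vectors $y_j\in\mathbb{R}^s$. Vector inequalities are componentwise. For a set $\Delta$ of scaling factors let $$T^{FDH_\Delta}=\Big\{(x,y)\in\mathbb{R}^m\times\mathbb{R}^s:\ \exists\,\mu\in\{0,1\}^n,\ \delta\in\Delta,\ \sum_{j}\mu_j=1,\ \lambda_j=\delta\mu_j\ (j\in J),\ \sum_j\lambda_jx_j\le x,\ \sum_j\lambda_jy_j\ge y\ge 0\Big\},$$ with $\Delta=\{1\}$ for $FDH_V$, $\Delta=\{\delta\ge0\}$ for $FDH_C$, $\Delta=\{0\le\delta\le1\}$ for $FDH_{NI}$, and $\Delta=\{\delta\ge1\}$ for $FDH_{ND}$. $DMU_o$ is $FDH_V$-efficient if there is no $(x,y)\in T^{FDH_V}$ with $x\le x_o$, $y\ge y_o$, $(x,y)\ne(x_o,y_o)$. The input-oriented radial efficiency measure $\theta_o^{\Delta}$, for each of $FDH_C$, $FDH_{NI}$, $FDH_{ND}$ with its corresponding set $\Delta$, is the minimum of $\theta$ subject to $\sum_j\lambda_jx_j\le\theta x_o$, $\sum_j\lambda_jy_j\ge y_o$, $\lambda_j=\delta\mu_j$, $\mu_j\in\{0,1\}$, $\sum_j\mu_j=1$, $\delta\in\Delta$. Global returns to scale for an $FDH_V$-efficient $DMU_o$: G-CRS prevails iff $\theta_o^{FDH_C}=\theta_o^{FDH_{NI}}=\theta_o^{FDH_{ND}}=1$; G-SCRS prevails iff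 $\theta_o^{FDH_C}=\theta_o^{FDH_{NI}}=\theta_o^{FDH_{ND}}<1$; G-IRS prevails iff $\theta_o^{FDH_{ND}}>\theta_o^{FDH_C}=\theta_o^{FDH_{NI}}$; G-DRS prevails iff $\theta_o^{FDH_{NI}}>\theta_o^{FDH_C}=\theta_o^{FDH_{ND}}$. Response function: $\beta_o(\alpha):=\max\{\beta\in\mathbb{R}:\ (\alpha x_o,\beta y_o)\in T^{FDH_V}\}$, defined for those $\alpha$ for which some such $\beta$ exists. Its domain is $[\underline{\alpha},+\infty)$ for some $\underline{\alpha}\le1$. Maximum incremental ratio and minimum decremental ratio: $$\sigma_o^+:=\max_{\alpha>1}\frac{\beta_o(\alpha)-1}{\alpha-1},\qquad \sigma_o^-:=\min_{\underline{\alpha}\le\alpha<1}\frac{\beta_o(\alpha)-1}{\alpha-1},$$ with the convention $\sigma_o^-=+\infty$ if $\underline{\alpha}=1$ (minimum over the empty set). $\operatorname{int}A$ and $A^c$ denote the interior and the complement of a set $A$ (in $\mathbb{R}^{m+s}$), and $z_\delta:=(\delta x_o,\delta y_o)$. One-sided returns to scale for an $FDH_V$-efficient $DMU_o$: Right-IRS prevails if $z_\delta\in\operatorname{int}T^{FDH_V}$ for some $\delta>1$; Right-DRS prevails if $z_\delta\in(T^{FDH_V})^c$ for each $\delta>1$; Right-CRS prevails if neither Right-IRS nor Right-DRS prevails. Left-IRS prevails if $z_\delta\in(T^{FDH_V})^c$ for each $0<\delta<1$; Left-DRS prevails if $z_\delta\in\operatorname{int}T^{FDH_V}$ for some $0<\delta<1$;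 Left-CRS prevails if neither Left-IRS nor Left-DRS prevails. Right-NIRS means that Right-CRS or Right-DRS prevails; Left-NDRS means that Left-CRS or Left-IRS prevails. *)

(* Defs.v *)
From mathcomp Require Import all_boot all_order all_algebra.
From mathcomp Require Import all_classical all_reals all_analysis.
Import Order.TTheory GRing.Theory Num.Theory.
Import numFieldNormedType.Exports.

Set Implicit Arguments.
Unset Strict Implicit.
Unset Printing Implicit Defensive.

Local Open Scope classical_set_scope.
Local Open Scope ring_scope.

(* Attained extrema; the default value 0 is returned when the extremum is not
   attained. *)
Definition maximum (R : realType) (A : set R) : R := xget 0 (A `&` ubound A).
Definition minimum (R : realType) (A : set R) : R := xget 0 (A `&` lbound A).

Definition vle (R : realType) (k : nat) (u v : 'rV[R]_k) : Prop :=
  forall i, u 0 i <= v 0 i.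

Definition Delta_V (R : realType) : set R := [set 1].
Definition Delta_C (R : realType) : set R := [set d | 0 <= d].
Definition Delta_NI (R : realType) : set R := [set d | 0 <= d <= 1].
Definition Delta_ND (R : realType) : set R := [set d | 1 <= d].

Section FreeDisposalHull.
Context (R : realType) (n m s : nat).
Context (x : 'I_n -> 'rV[R]_m) (y : 'I_n -> 'rV[R]_s).

(* The vectors (lambda_j) of the form delta * mu, with mu in {0,1}^n (encoded
   by booleans) of sum 1 and delta in Delta. *)
Definition intensity (Delta : set R) : set ('I_n -> R) :=
  [set lambda | exists (mu : {ffun 'I_n -> bool}) (delta : R),
    [/\ \sum_j (mu j)%:R = 1 :> R,
        Delta delta &
        forall j, lambda j = delta * (mu j)%:R]].

Definition FDH (Delta : set R) : set ('rV[R]_m * 'rV[R]_s) :=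
  [set z | exists lambda : 'I_n -> R,
    [/\ intensity Delta lambda,
        vle (\sum_j lambda j *: x j) z.1,
        vle z.2 (\sum_j lambda j *: y j) &
        vle 0 z.2]].

Definition T_V := FDH (@Delta_V R).

Definition FDHV_efficient (o : 'I_n) : Prop :=
  ~ exists z : 'rV[R]_m * 'rV[R]_s,
    [/\ T_V z, vle z.1 (x o), vle (y o) z.2 & z <> (x o, y o)].

Definition theta (Delta : set R) (o : 'I_n) : R :=
  minimum [set t | exists lambda : 'I_n -> R,
    [/\ intensity Delta lambda,
        vle (\sum_j lambda j *: x j) (t *: x o) &
        vle (y o) (\sum_j lambda j *: y j)]].

Definition theta_C := theta (@Delta_C R).
Definition theta_NI := theta (@Delta_NI R).
Definition theta_ND := theta (@Delta_ND R).

Definition G_CRS (o : 'I_n) : Prop :=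
  [/\ theta_C o = theta_NI o, theta_NI o = theta_ND o & theta_ND o = 1].
Definition G_SCRS (o : 'I_n) : Prop :=
  [/\ theta_C o = theta_NI o, theta_NI o = theta_ND o & theta_ND o < 1].
Definition G_IRS (o : 'I_n) : Prop :=
  theta_ND o > theta_C o /\ theta_C o = theta_NI o.
Definition G_DRS (o : 'I_n) : Prop :=
  theta_NI o > theta_C o /\ theta_C o = theta_ND o.

Definition response_set (o : 'I_n) (alpha : R) : set R :=
  [set beta | T_V (alpha *: x o, beta *: y o)].
Definition response (o : 'I_n) (alpha : R) : R :=
  maximum (response_set o alpha).

(* Left endpoint of the domain of the response function. *)
Definition alpha_low (o : 'I_n) : R :=
  minimum [set alpha | response_set o alpha !=set0].

Definition incr_ratio (o : 'I_n) (alpha : R) : R :=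
  (response o alpha - 1) / (alpha - 1).

Definition sigma_plus (o : 'I_n) : R :=
  maximum [set incr_ratio o alpha | alpha in [set alpha | 1 < alpha]].

Definition sigma_minus (o : 'I_n) : \bar R :=
  if alpha_low o == 1 then +oo%E
  else (minimum
    [set incr_ratio o alpha | alpha in [set alpha | alpha_low o <= alpha < 1]])%:E.

Definition ray (o : 'I_n) (delta : R) : 'rV[R]_m * 'rV[R]_s :=
  (delta *: x o, delta *: y o).

Definition Right_IRS (o : 'I_n) : Prop :=
  exists2 delta, 1 < delta & interior T_V (ray o delta).
Definition Right_DRS (o : 'I_n) : Prop :=
  forall delta, 1 < delta -> (~` T_V) (ray o delta).
Definition Right_CRS (o : 'I_n) : Prop := ~ Right_IRS o /\ ~ Right_DRS o.
Definition Right_NIRS (o : 'I_n) : Prop := Right_CRS o \/ Right_DRS o.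

Definition Left_IRS (o : 'I_n) : Prop :=
  forall delta, 0 < delta < 1 -> (~` T_V) (ray o delta).
Definition Left_DRS (o : 'I_n) : Prop :=
  exists2 delta, 0 < delta < 1 & interior T_V (ray o delta).
Definition Left_CRS (o : 'I_n) : Prop := ~ Left_IRS o /\ ~ Left_DRS o.
Definition Left_NDRS (o : 'I_n) : Prop := Left_CRS o \/ Left_IRS o.

End FreeDisposalHull.

(* Main.v *)
Require Import Defs.
From mathcomp Require Import all_boot all_order all_algebra.
From mathcomp Require Import all_classical all_reals all_analysis.
From mathcomp Require Import lra.
Import Order.TTheory GRing.Theory Num.Theory.
Import numFieldNormedType.Exports.

(** Everything takes place in the plane spanned by the input vector and the
    output vector of unit o.  A unit j is seen there through two numbers:
    [a j], the least [al] such that [x j <= al *: x o], and [b j], the greatest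
    [be] such that [be *: y o <= y j].  The section of the free disposal hull by
    this plane is the finite union of the quadrants [al >= a j],
    [0 <= be <= b j] ([T_V_plane]), so that
    - the response function is the step function
      [beta al = max {b j | a j <= al}] ([response_spec]);
    - the point of parameter [d] of the ray is interior to the hull iff
      [a j < d < b j] for some j ([interior_ray]);
    - the radial measure for a set Delta of scalings is the minimum of
      [d * a j] over the j and the [d] in Delta with [1 <= d * b j]
      ([theta_feasibleP]).

    Efficiency of o says that [a j <= 1 <= b j] forces [a j = b j = 1]
    ([efficient_scales]).

    Since [beta] only jumps at the finitely many numbers [a j], both extremal
    ratios are attained.  For [al > 1] the ratio [(beta al - 1) / (al - 1)]
    exceeds 1 iff [beta al > al], and for [al < 1] it is below 1 under the
    same condition; and [beta al > al] means [a j <= al < b j] for some j.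
    Moving [al] slightly to the right makes both inequalities strict, which is
    the interior condition defining Right-IRS and Left-DRS.  This gives the
    equivalences in (a) and (b) ([sigma_plus_gt1], [sigma_minus_lt1]), and (c)
    and (d) are Boolean combinations of them, because Right-NIRS and Left-NDRS
    are the negations of Right-IRS and Left-DRS.

    The implications from the global notions come from the radial measures.
    If [theta_NI < 1], an optimal pair has [d <= 1], hence [b j >= 1], and
    [d * a j < 1 <= d * b j] gives [a j < b j]; efficiency excludes [b j = 1],
    so Right-IRS holds ([theta_NI_lt1]).  If [theta_ND < 1], then [d >= 1],
    hence [a j < 1] and again [a j < b j]: Left-DRS holds ([theta_ND_lt1]).
    If [theta_C = 1], then [b j <= a j] for all j and no point of the ray is
    interior ([theta_C_eq1]). *)

Set Implicit Arguments.
Unset Strict Implicit.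
Unset Printing Implicit Defensive.

Local Open Scope classical_set_scope.
Local Open Scope ring_scope.

(** * Extrema over finitely many candidates *)

Section AttainedExtrema.
Context (R : realType).
Implicit Type A : set R.

Lemma maximumE A a : A a -> ubound A a -> maximum A = a.
Proof.
move=> Aa ubA; apply: xget_unique => // b [Ab ubB].
by apply/eqP; rewrite eq_le ubA //= ubB.
Qed.

Lemma minimumE A a : A a -> lbound A a -> minimum A = a.
Proof.
move=> Aa lbA; apply: xget_unique => // b [Ab lbB].
by apply/eqP; rewrite eq_le lbA //= andbT lbB.
Qed.

Lemma maximum_attained (I : finType) (i0 : I) (F : I -> R) A :
  (forall i, A (F i)) -> (forall a, A a -> exists i, a <= F i) ->
  A (maximum A) /\ ubound A (maximum A).
Proof.
move=> AF dom.
case: (@arg_maxP _ _ _ i0 predT F isT) => i _ maxF.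
have ubF : ubound A (F i).
  by move=> a /dom[j /le_trans]; apply; apply: maxF.
by rewrite (maximumE (AF i) ubF).
Qed.

Lemma minimum_attained (I : finType) (i0 : I) (P : pred I) (F : I -> R) A :
  P i0 -> (forall i, P i -> A (F i)) ->
  (forall a, A a -> exists2 i, P i & F i <= a) ->
  A (minimum A) /\ lbound A (minimum A).
Proof.
move=> Pi0 AF dom.
case: (@arg_minP _ _ _ i0 P F Pi0) => i Pi minF.
have lbF : lbound A (F i).
  by move=> a /dom[j Pj]; apply: le_trans; apply: minF.
by rewrite (minimumE (AF i Pi) lbF); split => //; apply: AF.
Qed.

End AttainedExtrema.

(** * Componentwise domination along a ray *)

Section Gauge.
Context (R : realType) (k : nat).
Implicit Types u v : 'rV[R]_k.

Definition gauge u v : R := \big[Num.max/0]_i (u 0 i / v 0 i).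

(** [gauge u v] is the least [r] such that [u <= r *: v].  The factor [t] in
    front of [u] lets the same lemma handle the inputs, where the unit vector
    [x o] is on the right, and the outputs, where [y o] is on the left; [t = 0]
    is allowed because null outputs and null scalings occur. *)
Lemma vle_gauge u v (t r : R) : (0 < k)%N ->
  (forall i, 0 < u 0 i) -> (forall i, 0 < v 0 i) -> 0 <= t ->
  vle (t *: u) (r *: v) <-> t * gauge u v <= r.
Proof.
move=> k_gt0 u_gt0 v_gt0 t_ge0; split=> [le_tu_rv | le_gr i]; last first.
  rewrite !mxE -ler_pdivrMr // (le_trans _ le_gr) // -mulrA ler_wpM2l //.
  exact: le_bigmax.
have le_i i : t * u 0 i <= r * v 0 i by have := le_tu_rv i; rewrite !mxE.
have r_ge0 : 0 <= r.
  rewrite -(pmulr_lge0 _ (v_gt0 (Ordinal k_gt0))).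
  by rewrite (le_trans _ (le_i _)) // mulr_ge0 // ltW.
have [->|t_neq0] := eqVneq t 0; first by rewrite mul0r.
have t_gt0 : 0 < t by rewrite lt_def t_neq0.
rewrite mulrC -ler_pdivlMr //; apply: bigmax_le => [|i _].
  by rewrite divr_ge0 // ltW.
by rewrite ler_pdivrMr // mulrAC ler_pdivlMr // mulrC.
Qed.

Lemma gauge_gt0 u v : (0 < k)%N ->
  (forall i, 0 < u 0 i) -> (forall i, 0 < v 0 i) -> 0 < gauge u v.
Proof.
move=> k_gt0 u_gt0 v_gt0.
by rewrite (lt_le_trans _ (le_bigmax _ _ (Ordinal k_gt0))) // divr_gt0.
Qed.

Lemma gauge_id u : (0 < k)%N -> (forall i, 0 < u 0 i) -> gauge u u = 1.
Proof.
move=> k_gt0 u_gt0; have ratio1 i : u 0 i / u 0 i = 1 by rewrite divff ?gt_eqF.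
apply/eqP; rewrite eq_le; apply/andP; split.
  by apply: bigmax_le => // i _; rewrite ratio1.
by rewrite -(ratio1 (Ordinal k_gt0)) le_bigmax.
Qed.

End Gauge.


(** * Intensity vectors and sets of scalings *)

Section Vertices.
Context (R : realType) (n : nat).

Lemma intensityP (Delta : set R) (lambda : 'I_n -> R) :
  intensity Delta lambda <->
  exists j d, Delta d /\ lambda = fun i => d * (i == j)%:R.
Proof.
split=> [[mu [d [sum_mu Dd lambdaE]]]|[j [d [Dd ->]]]].
  move: sum_mu; rewrite -natr_sum => /eqP; rewrite pnatr_eq1.
  move=> /sum_nat_eq1[j [_ mu_j mu_i]]; exists j, d; split=> //.
  apply/funext => i; rewrite lambdaE; congr (_ * _%:R).
  have [->//|/mu_i] := eqVneq i j; exact.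
exists [ffun i => i == j], d; split=> // [|i]; last by rewrite ffunE.
rewrite (bigD1 j) //= ffunE eqxx big1 ?addr0 // => i /negbTE ij.
by rewrite ffunE ij.
Qed.

Lemma sum_vertex k (v : 'I_n -> 'rV[R]_k) (j : 'I_n) (d : R) :
  \sum_i (d * (i == j)%:R) *: v i = d *: v j.
Proof.
rewrite (bigD1 j) //= eqxx mulr1 big1 ?addr0 // => i /negbTE ->.
by rewrite mulr0 scale0r.
Qed.

End Vertices.

(** In finite dimension, finitely many open conditions on separate coordinates
    define a neighbourhood. *)
Lemma near_coord (R : realType) k (u : 'rV[R]_k) (P : 'I_k -> set R) :
  (forall i, \forall t \near u 0 i, P i t) ->
  \forall v \near u, forall i, P i ((v : 'rV_k) 0 i).
Proof.
move=> nearP; exists (fun _ i => P i) => [i j|v Pv i]; last exact: Pv.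
by rewrite ord1; apply: nearP.
Qed.

Section AdmissibleScalings.
Context (R : realType).

(** What the radial measures need to know about the set of scalings: an optimal
    scaling of a given unit is the least one above the threshold imposed by the
    outputs, and the reference unit itself is feasible without scaling. *)
Definition admissible (Delta : set R) :=
  [/\ Delta 1, forall d, Delta d -> 0 <= d &
      forall r d, Delta d -> r <= d ->
        exists d0, [/\ Delta d0, r <= d0 &
                       forall e, Delta e -> r <= e -> d0 <= e]].

Lemma admissible_C : admissible (@Delta_C R).
Proof.
split=> [|//|r d _ _]; first exact: ler01.
exists (Num.max r 0); rewrite /Delta_C /= !le_max !lexx orbT.
by split=> // e e_ge0 re; rewrite ge_max re.
Qed.

Lemma admissible_NI : admissible (@Delta_NI R).
Proof.
split=> [|d /andP[]//|r d /andP[d_ge0 d_le1] rd].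
  by rewrite /Delta_NI /= ler01 lexx.
exists (Num.max r 0); rewrite /Delta_NI /= !le_max !lexx orbT ge_max ler01.
rewrite (le_trans rd) //; split=> // e /andP[e_ge0 _] re.
by rewrite ge_max re.
Qed.

Lemma admissible_ND : admissible (@Delta_ND R).
Proof.
split=> [|d|r d _ _]; [exact: lexx | exact: le_trans|].
exists (Num.max r 1); rewrite /Delta_ND /= !le_max !lexx orbT.
by split=> // e e_ge1 re; rewrite ge_max re.
Qed.

End AdmissibleScalings.

(** * The section of the hull by the plane of a unit *)

Section Frontier.
Context (R : realType) (n m s : nat).
Context (x : 'I_n -> 'rV[R]_m) (y : 'I_n -> 'rV[R]_s) (o : 'I_n).
Hypotheses (m_gt0 : (0 < m)%N) (s_gt0 : (0 < s)%N).
Hypotheses (x_gt0 : forall j i, 0 < x j 0 i) (y_gt0 : forall j i, 0 < y j 0 i).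

Definition input_scale (j : 'I_n) : R := gauge (x j) (x o).

(** The greatest [t] such that [t *: y o <= y j] is the inverse of the least
    [r] such that [y o <= r *: y j]. *)
Definition output_scale (j : 'I_n) : R := (gauge (y o) (y j))^-1.

Local Notation a := input_scale.
Local Notation b := output_scale.
Local Notation T := (T_V x y).
Local Notation beta := (response x y o).

Lemma input_scale_gt0 j : 0 < a j.
Proof. exact: gauge_gt0. Qed.

Lemma output_scale_gt0 j : 0 < b j.
Proof. by rewrite invr_gt0; apply: gauge_gt0. Qed.

Lemma input_scale_self : a o = 1.
Proof. exact: gauge_id. Qed.

Lemma output_scale_self : b o = 1.
Proof. by rewrite /output_scale gauge_id // invr1. Qed.

Lemma vle_input_scale j (d t : R) : 0 <= d ->
  vle (d *: x j) (t *: x o) <-> d * a j <= t.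
Proof. exact: vle_gauge. Qed.

Lemma vle_output_scale j (d t : R) : 0 <= t ->
  vle (t *: y o) (d *: y j) <-> t <= d * b j.
Proof.
by move=> t_ge0; rewrite ler_pdivlMr ?gauge_gt0 //; apply: vle_gauge.
Qed.

Lemma T_VP z : T z <->
  exists j, [/\ vle (x j) z.1, vle z.2 (y j) & vle 0 z.2].
Proof.
split=> [[lambda [/intensityP[j [d [-> ->]]]]]|[j [xz zy z_ge0]]].
  by rewrite !sum_vertex !scale1r => xz zy z_ge0; exists j.
exists (fun i => 1 * (i == j)%:R); rewrite !sum_vertex !scale1r; split=> //.
by apply/intensityP; exists j, 1.
Qed.

Lemma T_V_plane (al be : R) : T (al *: x o, be *: y o) <->
  0 <= be /\ exists j, a j <= al /\ be <= b j.
Proof.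
split=> [/T_VP[j /= [xz zy z_ge0]]|[be_ge0 [j [a_le b_ge]]]].
  have be_ge0 : 0 <= be.
    by have := z_ge0 (Ordinal s_gt0); rewrite !mxE pmulr_lge0.
  split=> //; exists j; split.
    by rewrite -[a j]mul1r; apply/vle_input_scale; rewrite ?scale1r.
  by rewrite -[b j]mul1r; apply/vle_output_scale; rewrite ?scale1r.
apply/T_VP; exists j; split=> /=.
- by rewrite -[x j]scale1r; apply/vle_input_scale; rewrite ?mul1r.
- by rewrite -[y j]scale1r; apply/vle_output_scale; rewrite ?mul1r.
- by move=> i; rewrite !mxE mulr_ge0 // ltW.
Qed.

Lemma theta_feasibleP (Delta : set R) (t : R) :
  (forall d, Delta d -> 0 <= d) ->
  (exists lambda, [/\ intensity Delta lambda,
     vle (\sum_j lambda j *: x j) (t *: x o) &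
     vle (y o) (\sum_j lambda j *: y j)]) <->
  exists j d, [/\ Delta d, 1 <= d * b j & d * a j <= t].
Proof.
move=> D_ge0; split=> [[lambda [/intensityP[j [d [Dd ->]]]]]|].
  rewrite !sum_vertex => xt ty; exists j, d; split=> //.
    by apply/vle_output_scale; rewrite ?scale1r.
  by apply/vle_input_scale => //; apply: D_ge0.
move=> [j [d [Dd b_ge a_le]]]; exists (fun i => d * (i == j)%:R).
rewrite !sum_vertex; split; first by apply/intensityP; exists j, d.
  by apply/vle_input_scale => //; apply: D_ge0.
by rewrite -[y o]scale1r; apply/vle_output_scale.
Qed.

(** An interior point stays in the hull after its inputs are decreased and its
    outputs increased by a small multiple of those of o, which makes both
    inequalities of [T_V_plane] strict.  Conversely, if they are strict then
    unit j strictly dominates the point in every coordinate, and still does so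
    nearby; the outputs also stay nonnegative because those of the point are
    positive. *)
Lemma interior_ray (d : R) : 0 < d ->
  interior T (ray x y o d) <-> exists j, a j < d < b j.
Proof.
move=> d_gt0; split=> [intT|[j /andP[a_lt b_gt]]].
  have cvg_perturbed :
      ((d - e) *: x o, (d + e) *: y o) @[e --> (0 : R)^'+] --> ray x y o d.
    have cvg0 : (e : R) @[e --> (0 : R)^'+] --> (0 : R).
      exact: cvg_at_right_filter.
    have cvg_x : (d - e) *: x o @[e --> (0 : R)^'+] --> d *: x o.
      apply: cvgZr_tmp; rewrite -[X in _ --> X]subr0.
      by apply: cvgB => //; apply: cvg_cst.
    have cvg_y : (d + e) *: y o @[e --> (0 : R)^'+] --> d *: y o.
      apply: cvgZr_tmp; rewrite -[X in _ --> X]addr0.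
      by apply: cvgD => //; apply: cvg_cst.
    exact: cvg_pair cvg_x cvg_y.
  have : \forall e \near (0 : R)^'+,
      0 < e /\ T ((d - e) *: x o, (d + e) *: y o).
    by apply: filterI; [apply: nbhs_right_gt | apply: (cvg_perturbed _ intT)].
  move=> /filter_ex[e [e_gt0 /T_V_plane[_ [j [a_le b_ge]]]]].
  by exists j; apply/andP; split; lra.
have x_lt i : x j 0 i < d * x o 0 i.
  have /vle_input_scale-/(_ ler01 i) : 1 * a j <= a j by rewrite mul1r.
  by rewrite !mxE mul1r => /le_lt_trans; apply; rewrite ltr_pM2r.
have y_gt i : d * y o 0 i < y j 0 i.
  have /vle_output_scale-/(_ (ltW (output_scale_gt0 j)) i) :
    b j <= 1 * b j by rewrite mul1r.
  by rewrite !mxE mul1r; apply: lt_le_trans; rewrite ltr_pM2r.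
have near_x : \forall u \near (d *: x o : 'rV[R]_m),
    forall i, x j 0 i < (u : 'rV_m) 0 i.
  by apply: (near_coord (P := fun i t => x j 0 i < t)) => i;
    apply: lt_nbhsr; rewrite mxE.
have near_y : \forall v \near (d *: y o : 'rV[R]_s),
    forall i, 0 < (v : 'rV_s) 0 i < y j 0 i.
  apply: (near_coord (P := fun i t => 0 < t < y j 0 i)) => i.
  have dy_gt0 : 0 < (d *: y o) 0 i by rewrite mxE mulr_gt0.
  have dy_lt : (d *: y o) 0 i < y j 0 i by rewrite mxE.
  near=> t; apply/andP; split; near: t; [exact: lt_nbhsr | exact: lt_nbhsl].
exists ([set u : 'rV_m | forall i, x j 0 i < u 0 i],
        [set v : 'rV_s | forall i, 0 < v 0 i < y j 0 i]) => //.
move=> [u v] [/= xu vy]; apply/T_VP; exists j; split=> i /=.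
- exact: ltW.
- by have /andP[_ /ltW] := vy i.
- by rewrite mxE; have /andP[/ltW] := vy i.
Unshelve. all: by end_near. Qed.

Hypothesis eff : FDHV_efficient x y o.

Lemma efficient_scales j : a j <= 1 -> 1 <= b j -> a j = 1 /\ b j = 1.
Proof.
move=> a_le1 b_ge1.
suff [xj yj] : (x j, y j) = (x o, y o).
  by rewrite /input_scale /output_scale xj yj !gauge_id // invr1.
apply: contrapT => neq; apply: eff; exists (x j, y j).
have ge0 : vle 0 (y j) by move=> i; rewrite mxE ltW.
split=> //=; first by apply/T_VP; exists j; split=> //= i.
- rewrite -[x j]scale1r -[x o]scale1r.
  by apply/vle_input_scale; rewrite ?mul1r.
- rewrite -[y j]scale1r -[y o]scale1r.
  by apply/vle_output_scale; rewrite ?mul1r.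
Qed.

(** * One-sided returns to scale as conditions on the scales *)

Lemma Right_IRSP : Right_IRS x y o <-> exists j d, 1 < d /\ a j < d < b j.
Proof.
split=> [[d d_gt1 /interior_ray[|j jd]]|[j [d [d_gt1 jd]]]].
- exact: lt_trans d_gt1.
- by exists j, d.
- by exists d => //; apply/interior_ray; [apply: lt_trans d_gt1 | exists j].
Qed.

Lemma Left_DRSP : Left_DRS x y o <-> exists j d, 0 < d < 1 /\ a j < d < b j.
Proof.
split=> [[d d01 /interior_ray[|j jd]]|[j [d [d01 jd]]]].
- by case/andP: d01.
- by exists j, d.
- by exists d => //; apply/interior_ray; [case/andP: d01 | exists j].
Qed.

Lemma Right_NIRSP : Right_NIRS x y o <-> ~ Right_IRS x y o.
Proof.
split=> [[[]//|drs [d d_gt1 /interior_subset]]|nirs]; first exact: drs.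
by have [drs|ndrs] := pselect (Right_DRS x y o); [right | left].
Qed.

Lemma Left_NDRSP : Left_NDRS x y o <-> ~ Left_DRS x y o.
Proof.
split=> [[[]//|irs [d d01 /interior_subset]]|ndrs]; first exact: irs.
by have [irs|nirs] := pselect (Left_IRS x y o); [right | left].
Qed.

(** * The response function and its incremental ratios *)

Lemma response_spec (j : 'I_n) (al : R) : a j <= al ->
  exists k, [/\ a k <= al, beta al = b k & forall i, a i <= al -> b i <= b k].
Proof.
move=> j_al.
case: (@arg_maxP _ _ _ j (fun i => a i <= al) b j_al) => k k_al maxk.
exists k; split=> //; apply: maximumE => [|be /T_V_plane[_ [i [i_al be_le]]]].
  by apply/T_V_plane; split; [apply/ltW/output_scale_gt0 | exists k].
by rewrite (le_trans be_le) //; apply: maxk.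
Qed.

Lemma response_ge (j : 'I_n) (al : R) : a j <= al -> b j <= beta al.
Proof. by move=> j_al; have [k [_ -> ->]] := response_spec j_al. Qed.

Lemma response_ge1 (al : R) : 1 <= al -> 1 <= beta al.
Proof.
have := @response_ge o al; rewrite input_scale_self output_scale_self; exact.
Qed.

Lemma incr_ratio_gt1 (al : R) : 1 < al ->
  (1 < incr_ratio x y o al) = (al < beta al).
Proof.
by move=> ?; rewrite ltr_pdivlMr ?subr_gt0 // mul1r ltrD2r.
Qed.

Lemma incr_ratio_lt1 (al : R) : al < 1 ->
  (incr_ratio x y o al < 1) = (al < beta al).
Proof.
by move=> ?; rewrite ltr_ndivrMr ?subr_lt0 // mul1r ltrD2r.
Qed.

(** Between two jumps of [beta] the ratio, which is nonnegative, does not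
    increase, so its largest values are found at the jumps [a j > 1].  The units
    with [a j <= 1] only yield the ratio 0, by efficiency; the point 2 stands
    for them, and any other point of the domain would do since no ratio is
    negative. *)
Lemma sigma_plus_attained :
  let A := [set incr_ratio x y o al | al in [set al | 1 < al]] in
  A (sigma_plus x y o) /\ ubound A (sigma_plus x y o).
Proof.
pose jump j := if 1 < a j then a j else 2.
apply: (@maximum_attained _ _ o (fun j => incr_ratio x y o (jump j))).
  move=> j; exists (jump j) => //=; rewrite /jump.
  by case: ifP => // _; rewrite ltr1n.
move=> _ [al /= al_gt1 <-].
have o_al : a o <= al by rewrite input_scale_self ltW.
have [j [j_al betaE _]] := response_spec o_al.
exists j; rewrite /jump /incr_ratio betaE; case: ltP => [aj_gt1|aj_le1].
  have bj_le := response_ge (lexx (a j)).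
  have one_le := response_ge1 (ltW aj_gt1).
  apply: (@le_trans _ _ ((beta (a j) - 1) / (al - 1))).
    by rewrite ler_wpM2r ?invr_ge0 ?lerD2r // subr_ge0 ltW.
  by rewrite ler_wpM2l ?subr_ge0 // lef_pV2 ?posrE ?subr_gt0 // lerD2r.
have bj_le1 : b j <= 1.
  rewrite leNgt; apply/negP => bj.
  by have [_ bj1] := efficient_scales aj_le1 (ltW bj); lra.
have one_le : 1 <= beta 2 by apply: response_ge1; rewrite ler1n.
apply: (@le_trans _ _ 0).
  by rewrite pmulr_lle0 ?subr_cp0 // invr_gt0 subr_gt0.
by rewrite divr_ge0 // subr_ge0 //; lra.
Qed.

(** The ratio exceeds 1 at [al] when the response lies above the diagonal; the
    midpoint of [al] and of the response is then a parameter at which the ray is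
    interior to the hull. *)
Lemma sigma_plus_gt1 : 1 < sigma_plus x y o <-> Right_IRS x y o.
Proof.
have [[al /= al_gt1 alE] ub] := sigma_plus_attained.
apply: iff_trans (iff_sym Right_IRSP).
split=> [|[j [d [d_gt1 /andP[jd d_lt]]]]].
  rewrite -alE incr_ratio_gt1 // => al_lt.
  have o_al : a o <= al by rewrite input_scale_self ltW.
  have [k [k_al betaE _]] := response_spec o_al.
  rewrite betaE in al_lt; exists k, ((al + b k) / 2).
  by have [mid_gt mid_lt] := midf_lt al_lt; split; [|apply/andP; split]; lra.
apply: (@lt_le_trans _ _ (incr_ratio x y o d)); last by apply: ub; exists d.
rewrite incr_ratio_gt1 //; apply: lt_le_trans d_lt _.
by apply: response_ge; apply: ltW.
Qed.

Lemma alpha_low_spec :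
  (exists j, alpha_low x y o = a j) /\ forall j, alpha_low x y o <= a j.
Proof.
case: (@arg_minP _ _ _ o predT a isT) => k _ mink.
suff -> : alpha_low x y o = a k by split=> [|j]; [exists k | apply: mink].
apply: minimumE => [|al [be /T_V_plane[_ [j [j_al _]]]]].
  exists 0; apply/T_V_plane; split=> //.
  by exists k; split=> //; apply: ltW (output_scale_gt0 k).
by rewrite (le_trans _ j_al) //; apply: mink.
Qed.

Lemma response_lt1 (al : R) : alpha_low x y o <= al < 1 -> beta al < 1.
Proof.
move=> /andP[low_al al_lt1]; have [[j lowE] _] := alpha_low_spec.
rewrite lowE in low_al; have [k [k_al -> _]] := response_spec low_al.
rewrite ltNge; apply/negP => bk; have ak : a k <= 1 by lra.
by have [ak1 _] := efficient_scales ak bk; lra.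
Qed.

(** For [al < 1] the ratio is [(1 - beta al) / (1 - al)] with [beta al < 1], by
    efficiency; it increases between two jumps of [beta], so its smallest values
    are found at the jumps [a j < 1]. *)
Lemma sigma_minus_attained : alpha_low x y o < 1 ->
  let A := [set incr_ratio x y o al |
            al in [set al | alpha_low x y o <= al < 1]] in
  A (minimum A) /\ lbound A (minimum A).
Proof.
have [[j0 lowE] low_le] := alpha_low_spec.
move=> low_lt1 A.
apply: (@minimum_attained _ _ j0 (fun j => a j < 1)
          (fun j => incr_ratio x y o (a j))) => [|j aj_lt1|].
- by rewrite -lowE.
- by exists (a j) => //=; rewrite low_le.
move=> _ [al /= al_dom <-].
have /andP[low_al al_lt1] := al_dom.
have j0_al : a j0 <= al by rewrite -lowE.
have [j [j_al betaE _]] := response_spec j0_al.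
have aj_lt1 : a j < 1 by lra.
have bj_lt1 : b j < 1 by rewrite -betaE; apply: response_lt1.
exists j => //; rewrite /incr_ratio betaE.
have bj_le := response_ge (lexx (a j)).
have beta_lt1 : beta (a j) < 1 by apply: response_lt1; rewrite low_le.
rewrite -mulrNN -invrN -[leRHS]mulrNN -invrN !opprB.
apply: (@le_trans _ _ ((1 - b j) / (1 - a j))).
  by apply: ler_wpM2r; [rewrite invr_ge0 subr_ge0 ltW | lra].
apply: ler_wpM2l; first by lra.
by rewrite lef_pV2 ?posrE ?subr_gt0 // lerD2l lerN2.
Qed.

Lemma sigma_minus_lt1 :
  (sigma_minus x y o < 1%:E)%E <-> Left_DRS x y o.
Proof.
have [[j0 lowE] low_le] := alpha_low_spec.
apply: iff_trans (iff_sym Left_DRSP); rewrite /sigma_minus.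
case: eqVneq => [low1|low_neq1].
  split=> [//|[j [d [/andP[_ d_lt1] /andP[jd _]]]]].
  by exfalso; have := low_le j; lra.
have low_lt1 : alpha_low x y o < 1.
  by rewrite lt_neqAle low_neq1 -input_scale_self low_le.
have [[al /= al_dom alE] lb] := sigma_minus_attained low_lt1.
have /andP[low_al al_lt1] := al_dom.
rewrite lte_fin; split=> [|[j [d [/andP[d_gt0 d_lt1] /andP[jd d_lt]]]]].
  rewrite -alE incr_ratio_lt1 // => al_lt.
  have j0_al : a j0 <= al by rewrite -lowE.
  have [k [k_al betaE _]] := response_spec j0_al.
  have bk_lt1 : b k < 1 by rewrite -betaE; apply: response_lt1.
  rewrite betaE in al_lt; have ak_gt0 := input_scale_gt0 k.
  exists k, ((al + b k) / 2); have [mid_gt mid_lt] := midf_lt al_lt.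
  by split; apply/andP; split; lra.
apply: (@le_lt_trans _ _ (incr_ratio x y o d)).
  apply: lb; exists d => //=; rewrite d_lt1 andbT.
  by apply: le_trans (low_le j) (ltW jd).
rewrite incr_ratio_lt1 //; apply: lt_le_trans d_lt _.
by apply: response_ge; apply: ltW.
Qed.

(** * Radial measures *)

(** For a fixed unit j the best scaling is the least element of Delta above
    [(b j)^-1], if there is one; only finitely many values then compete. *)
Lemma theta_attained (Delta : set R) :
  admissible Delta ->
  (exists j d, [/\ Delta d, 1 <= d * b j & d * a j <= theta x y Delta o]) /\
  (forall j d, Delta d -> 1 <= d * b j -> theta x y Delta o <= d * a j).
Proof.
move=> [D1 D_ge0 D_least].
have b_ge j d : (1 <= d * b j) = ((b j)^-1 <= d).
  by rewrite -ler_pdivrMr ?output_scale_gt0 // div1r.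
pose feasible j := `[< exists2 d, Delta d & 1 <= d * b j >].
have least j : feasible j -> exists d0, [/\ Delta d0, 1 <= d0 * b j &
    forall e, Delta e -> 1 <= e * b j -> d0 <= e].
  move=> /asboolP[d Dd]; rewrite b_ge => /(D_least _ _ Dd)[d0 [D0 r0 min0]].
  by exists d0; split=> // [|e De]; rewrite b_ge //; apply: min0.
have /choice[d0 d0P] : forall j, exists d0, feasible j -> [/\ Delta d0,
    1 <= d0 * b j & forall e, Delta e -> 1 <= e * b j -> d0 <= e].
  move=> j; have [/least[d0 d0P]|nfeas] := boolP (feasible j).
    by exists d0.
  by exists 0 => fj; case/negP: nfeas.
have feas_o : feasible o.
  by apply/asboolP; exists 1; rewrite // mul1r output_scale_self.
have [|j fj|t /theta_feasibleP-/(_ D_ge0)[j [d [Dd bj aj]]]|] :=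
    @minimum_attained R _ o feasible (fun j => d0 j * a j)
  [set t | exists lambda, [/\ intensity Delta lambda,
     vle (\sum_j lambda j *: x j) (t *: x o) &
     vle (y o) (\sum_j lambda j *: y j)]] => //.
- by apply/theta_feasibleP => //; have [D0 b0 _] := d0P j fj; exists j, (d0 j).
- have fj : feasible j by apply/asboolP; exists d.
  have [_ _ min0] := d0P j fj; exists j => //; apply: le_trans aj.
  by rewrite ler_wpM2r ?(ltW (input_scale_gt0 j)) // min0.
move=> /theta_feasibleP-/(_ D_ge0) attained lb; split=> // j d Dd bj.
by apply: lb; apply/theta_feasibleP => //; exists j, d.
Qed.

Lemma theta_C_eq1 : theta_C x y o = 1 -> forall j, b j <= a j.
Proof.
move=> thetaC j; have [_ lb] := theta_attained (admissible_C R).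
have bj_gt0 := output_scale_gt0 j.
have := lb j (b j)^-1; rewrite /Delta_C /= invr_ge0 mulVf ?gt_eqF //.
rewrite -/(theta_C x y o) thetaC => /(_ (ltW bj_gt0) (lexx 1)).
by rewrite mulrC ler_pdivlMr // mul1r.
Qed.

(** A unit that improves on o after being scaled down must have outputs at least
    as large as o in every component, hence some larger input by efficiency,
    and, compared with o, its outputs grow more than its inputs. *)
Lemma theta_NI_lt1 : theta_NI x y o < 1 -> Right_IRS x y o.
Proof.
rewrite /theta_NI => theta_lt1.
have [[j [d [/andP[d_ge0 d_le1] bj aj]]] _] := theta_attained (admissible_NI R).
have aj_gt0 := input_scale_gt0 j; have bj_gt0 := output_scale_gt0 j.
have d_gt0 : 0 < d.
  by rewrite lt_def d_ge0 andbT; apply: contraTneq bj => ->; lra.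
have bj_ge1 : 1 <= b j by nra.
have ab : a j < b j by rewrite -(ltr_pM2l d_gt0); lra.
have bj_gt1 : 1 < b j.
  rewrite lt_neqAle bj_ge1 andbT; apply/eqP => bj1.
  have aj_le1 : a j <= 1 by lra.
  by have [aj1 _] := efficient_scales aj_le1 bj_ge1; lra.
apply/Right_IRSP; have [aj_ge1|aj_lt1] := lerP 1 (a j).
  exists j, ((a j + b j) / 2); have [mid_gt mid_lt] := midf_lt ab.
  by split; [|apply/andP; split]; lra.
exists j, ((1 + b j) / 2); have [mid_gt mid_lt] := midf_lt bj_gt1.
by split; [|apply/andP; split]; lra.
Qed.

(** A unit that improves on o after being scaled up must have smaller inputs
    than o, hence some smaller output by efficiency, and its inputs shrink more
    than its outputs. *)
Lemma theta_ND_lt1 : theta_ND x y o < 1 -> Left_DRS x y o.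
Proof.
rewrite /theta_ND => theta_lt1.
have [[j [d [d_ge1 bj aj]]] _] := theta_attained (admissible_ND R).
rewrite /Delta_ND /= in d_ge1.
have aj_gt0 := input_scale_gt0 j; have bj_gt0 := output_scale_gt0 j.
have d_gt0 : 0 < d by lra.
have ab : a j < b j by rewrite -(ltr_pM2l d_gt0); lra.
have aj_lt1 : a j < 1 by nra.
have bj_lt1 : b j < 1.
  rewrite ltNge; apply/negP => bj1.
  by have [aj1 _] := efficient_scales (ltW aj_lt1) bj1; lra.
apply/Left_DRSP; exists j, ((a j + b j) / 2).
by have [mid_gt mid_lt] := midf_lt ab; split; apply/andP; split; lra.
Qed.

Lemma theta_le1 (Delta : set R) : admissible Delta -> theta x y Delta o <= 1.
Proof.
move=> adm; have [_ lb] := theta_attained adm; have [D1 _ _] := adm.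
have := lb o 1 D1; rewrite !mul1r output_scale_self input_scale_self.
exact.
Qed.

End Frontier.

(** * Global and one-sided returns to scale *)

Theorem theorem7 (R : realType) (n m s : nat)
  (x : 'I_n -> 'rV[R]_m) (y : 'I_n -> 'rV[R]_s) (o : 'I_n)
  (m_gt0 : (0 < m)%N) (s_gt0 : (0 < s)%N)
  (x_gt0 : forall j i, 0 < x j 0 i) (y_gt0 : forall j i, 0 < y j 0 i)
  (eff : FDHV_efficient x y o) :
  [/\ (G_IRS x y o -> Right_IRS x y o) /\
      (Right_IRS x y o <-> 1 < sigma_plus x y o),
      (G_DRS x y o -> Left_DRS x y o) /\
      (Left_DRS x y o <-> (sigma_minus x y o < 1%:E)%E),
      (G_CRS x y o -> Right_NIRS x y o /\ Left_NDRS x y o) /\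
      (Right_NIRS x y o /\ Left_NDRS x y o <->
       sigma_plus x y o <= 1 /\ (1%:E <= sigma_minus x y o)%E) &
      (G_SCRS x y o -> Right_IRS x y o /\ Left_DRS x y o) /\
      (Right_IRS x y o /\ Left_DRS x y o <->
       1 < sigma_plus x y o /\ (sigma_minus x y o < 1%:E)%E)].
Proof.
have right_irs := sigma_plus_gt1 m_gt0 s_gt0 x_gt0 y_gt0 eff.
have left_drs := sigma_minus_lt1 m_gt0 s_gt0 x_gt0 y_gt0 eff.
have NI_lt1 := theta_NI_lt1 m_gt0 s_gt0 x_gt0 y_gt0 eff.
have ND_lt1 := theta_ND_lt1 m_gt0 s_gt0 x_gt0 y_gt0 eff.
have NI_le1 : theta_NI x y o <= 1.
  exact: theta_le1 (admissible_NI R).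
have ND_le1 : theta_ND x y o <= 1.
  exact: theta_le1 (admissible_ND R).
split; split.
- by move=> [C_lt CE]; apply: NI_lt1; rewrite -CE; apply: lt_le_trans ND_le1.
- exact: iff_sym.
- by move=> [C_lt CE]; apply: ND_lt1; rewrite -CE; apply: lt_le_trans NI_le1.
- exact: iff_sym.
- move=> [C_NI NI_ND ND1].
  have theta_C1 : theta_C x y o = 1 by rewrite C_NI NI_ND.
  have b_le_a := theta_C_eq1 m_gt0 s_gt0 x_gt0 y_gt0 theta_C1.
  split; [apply/Right_NIRSP | apply/Left_NDRSP].
    move=> /(Right_IRSP _ m_gt0 s_gt0 x_gt0 y_gt0)[j [d [_ /andP[]]]].
    by have := b_le_a j; lra.
  move=> /(Left_DRSP _ m_gt0 s_gt0 x_gt0 y_gt0)[j [d [_ /andP[]]]].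
  by have := b_le_a j; lra.
- rewrite Right_NIRSP Left_NDRSP -right_irs -left_drs !leNgt.
  by split=> [[/negP ? /negP ?]|[/negP ? /negP ?]].
- move=> [C_NI NI_ND ND_lt]; split; [apply: NI_lt1 | exact: ND_lt1].
  by rewrite NI_ND.
- by rewrite -right_irs -left_drs.
Qed.
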